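(* Let $L$ be a finite-dimensional extraspecial Leibniz algebra over a field. Then $L$ is upper semi-modular if and only if $J=\{x\in L\mid x^2=0\}$ is an abelian ideal of $L$.
   Context: A (right) Leibniz algebra over a field $F$ is an $F$-vector space $L$ with a bilinear product $[\cdot,\cdot]$ satisfying $[x,[y,z]]=[[x,y],z]-[[x,z],y]$ for all $x,y,z\in L$; write $x^2=[x,x]$. The centre is $Z(L)=\{z\in L\mid [z,x]=[x,z]=0 \text{ for all } x\in L\}$. $L$ is extraspecial if $\dim Z(L)=1$ and $L/Z(L)$ is abelian (all products zero). For subalgebras $U,B$, $\langle U,B\rangle$ denotes the subalgebra generated by $U\cup B$. A subalgebra $U$ of $L$ is upper semi-modular in $L$ if $U$ is a maximal subalgebra of $\langle U,B\rangle$ for every subalgebra $B$ of $L$ such that $U\cap B$ is maximal in $B$. $L$ is upper semi-modular if every subalgebra of $L$ is upper semi-modular in $L$. *)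

(* Defs.v *)
From HB Require Import structures.
From mathcomp Require Import all_boot all_order all_algebra.

Set Implicit Arguments.
Unset Strict Implicit.
Unset Printing Implicit Defensive.

Import GRing.Theory.
Local Open Scope ring_scope.

(* Right Leibniz algebras: right multiplications are derivations. *)
HB.mixin Record Lmodule_isLeibniz (F : fieldType) L of GRing.Lmodule F L := {
  bracket : L -> L -> L;
  bracket_bilinear : bilinear_for *:%R *:%R bracket;
  bracket_leibniz : forall x y z : L,
    bracket x (bracket y z) = bracket (bracket x y) z - bracket (bracket x z) y
}.

#[short(type="leibnizType")]
HB.structure Definition Leibniz (F : fieldType) :=
  {L of Lmodule_isLeibniz F L & GRing.Lmodule F L}.

#[short(type="finLeibnizType")]
HB.structure Definition FinLeibniz (F : fieldType) :=
  {L of Leibniz F L & Vector F L}.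

Section LeibnizTheory.
Context {F : fieldType} {L : leibnizType F}.
Implicit Types (a : F) (x y z : L).

Lemma bracketPl y a x z : bracket (a *: x + z) y = a *: bracket x y + bracket z y.
Proof. exact: (bracket_bilinear.1 y). Qed.

Lemma bracketPr x a y z : bracket x (a *: y + z) = a *: bracket x y + bracket x z.
Proof. exact: (bracket_bilinear.2 x). Qed.

HB.instance Definition _ x :=
  GRing.isLinear.Build F L L *:%R (bracket x) (bracketPr x).

(* Right multiplication as a function of its left argument. *)
Definition bracketr y x := bracket x y.

HB.instance Definition _ y :=
  GRing.isLinear.Build F L L *:%R (bracketr y) (bracketPl y).

Definition is_abelian (S : {pred L}) : Prop :=
  {in S &, forall x y, bracket x y = 0}.

Definition is_ideal (S : {pred L}) : Prop :=
  submod_closed S /\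
  {in S, forall x, forall y, bracket x y \in S /\ bracket y x \in S}.

Definition is_abelian_ideal (S : {pred L}) : Prop := is_ideal S /\ is_abelian S.

End LeibnizTheory.

Definition abelian_algebra (F : fieldType) (L : leibnizType F) : Prop :=
  forall x y : L, bracket x y = 0.

Section FinLeibnizTheory.
Context {F : fieldType} {L : finLeibnizType F}.
Implicit Types (a : F) (x y z : L) (U V B S W : {vspace L}).

(* z |-> ([z, -], [-, z]), whose kernel is the centre; see centreP. *)
Definition bracket_pair z : 'Hom(L, L) * 'Hom(L, L) :=
  (linfun (bracket z), linfun (bracketr z)).

Fact bracket_pair_linear : linear bracket_pair.
Proof.
move=> a x y; rewrite /bracket_pair; congr (_, _); apply/lfunP=> z;
  rewrite add_lfunE scale_lfunE !lfunE.
- exact: bracketPl.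
- exact: bracketPr.
Qed.
HB.instance Definition _ :=
  GRing.isLinear.Build F L ('Hom(L, L) * 'Hom(L, L))%type *:%R bracket_pair
    bracket_pair_linear.

Definition centre : {vspace L} := lker (linfun bracket_pair).

Lemma centreP z :
  reflect (forall x, bracket z x = 0 /\ bracket x z = 0) (z \in centre).
Proof.
rewrite memv_ker lfunE /=; apply: (iffP eqP) => [[/lfunP zl /lfunP zr] x|zz].
  by have := zl x; have := zr x; rewrite !lfunE.
by congr (_, _); apply/lfunP=> x; rewrite !lfunE /=; case: (zz x).
Qed.

Definition is_subalgebra U : Prop := {in U &, forall x y, bracket x y \in U}.

Definition is_maximal_subalgebra U V : Prop :=
  [/\ is_subalgebra U, (U <= V)%VS, U != V
    & forall W, is_subalgebra W -> (U <= W)%VS -> (W <= V)%VS ->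
        W = U \/ W = V].

Definition adjoin_brackets W : {vspace L} :=
  (W + <<[seq bracket x y | x <- vbasis W, y <- vbasis W]>>)%VS.

(* The subalgebra generated by U and B, as the limit of the chain W, W + [W, W],
   ..., starting from U + B, which is stationary after at most \dim L steps.
   The lemmas generatedP and generated_min state that it is the least
   subalgebra containing both U and B. *)
Definition generated U B : {vspace L} :=
  iter (\dim (fullv : {vspace L})) adjoin_brackets (U + B)%VS.

Lemma adjoin_sub W : (W <= adjoin_brackets W)%VS.
Proof. exact: addvSl. Qed.

Lemma memv_adjoin W : {in W &, forall x y, bracket x y \in adjoin_brackets W}.
Proof.
move=> x y Wx Wy; rewrite (coord_vbasis Wx) (coord_vbasis Wy).
rewrite linear_sum /=; apply: rpred_sum => j _; rewrite linearZ rpredZ //=.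
rewrite -/(bracketr _ _) linear_sum; apply: rpred_sum => i _.
rewrite linearZ rpredZ //= (subvP (addvSr _ _)) // memv_span //.
by apply/allpairsP; exists ((vbasis W)`_i, (vbasis W)`_j); rewrite !memt_nth.
Qed.

Lemma adjoin_min W S : is_subalgebra S -> (W <= S)%VS ->
  (adjoin_brackets W <= S)%VS.
Proof.
move=> aS WS; rewrite subv_add WS.
apply/span_subvP => _ /allpairsP[[x y] [/= Wx Wy ->]].
by apply: aS; apply: (subvP WS); apply: vbasis_mem.
Qed.

Lemma generated_min U B S : is_subalgebra S -> (U <= S)%VS -> (B <= S)%VS ->
  (generated U B <= S)%VS.
Proof.
move=> aS US BS; rewrite /generated; elim: (\dim _) => [|n IHn] /=.
  by rewrite subv_add US.
exact: adjoin_min.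
Qed.

Lemma generatedP U B :
  [/\ is_subalgebra (generated U B), (U <= generated U B)%VS
    & (B <= generated U B)%VS].
Proof.
pose c n := iter n adjoin_brackets (U + B)%VS.
have c0 n : (U + B <= c n)%VS.
  by elim: n => //= n IHn; apply: subv_trans (adjoin_sub _).
have stat n : (n <= \dim (c n))%N \/ adjoin_brackets (c n) = c n.
  elim: n => [|n [IHn|IHn]]; [by left| |by right; rewrite /= IHn].
  have [e|ne] := eqVneq (adjoin_brackets (c n)) (c n); first by right; rewrite /= !e.
  left; apply: leq_ltn_trans IHn _; rewrite ltn_neqAle dimvS ?adjoin_sub // andbT.
  apply: contra_neq ne => e; apply/esym/eqP.
  by rewrite eqEdim adjoin_sub /= -/(c n) e.
have fix_c : adjoin_brackets (generated U B) = generated U B.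
  rewrite /generated -/(c _); set d := \dim _.
  have [le_d|//] := stat d.
  have full : c d = fullv.
    by apply/eqP; rewrite eqEdim subvf.
  by apply/eqP; rewrite full eqEsubv subvf adjoin_sub.
split; last 2 first.
- exact: subv_trans (addvSl _ _) (c0 _).
- exact: subv_trans (addvSr _ _) (c0 _).
by move=> x y gx gy; rewrite -fix_c; apply: memv_adjoin.
Qed.

Definition upper_semimodular_in U : Prop :=
  forall B, is_subalgebra B -> is_maximal_subalgebra (U :&: B)%VS B ->
    is_maximal_subalgebra U (generated U B).

End FinLeibnizTheory.

Arguments centre {F} L.

Section CentralQuotient.
Context {F : fieldType}.
Variable L : finLeibnizType F.
Implicit Types (a b : F) (x y z : L).
Local Open Scope quotient_scope.

Definition central_quotient : Type := Quotient.quot (centre L).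
Local Notation Q := central_quotient.

HB.instance Definition _ := GRing.Zmodule.on Q.

Definition central_pi x : Q := \pi_(Quotient.quot (centre L)) x.
Local Notation pi := central_pi.

Lemma central_pi_eqP x y : pi x = pi y <-> x - y \in centre L.
Proof. by rewrite Quotient.idealrBE; split=> [e|/eqP //]; apply/eqP. Qed.

Lemma central_pi_surj (q : Q) : exists x, q = pi x.
Proof. by exists (repr q); rewrite /central_pi reprK. Qed.

Lemma central_piD x y : pi (x + y) = pi x + pi y.
Proof. exact: (@Quotient.pi_add L (centre L)). Qed.

Lemma central_piB x y : pi (x - y) = pi x - pi y.
Proof.
by apply: (canRL (addrK _)); rewrite -central_piD subrK.
Qed.

Definition quot_scale a (q : Q) : Q := pi (a *: repr q).
Definition quot_bracket (p q : Q) : Q := pi (bracket (repr p) (repr q)).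

Lemma repr_pi x : repr (pi x) - x \in centre L.
Proof. by apply/central_pi_eqP; rewrite /central_pi reprK. Qed.

Lemma quot_scaleE a x : quot_scale a (pi x) = pi (a *: x).
Proof. by apply/central_pi_eqP; rewrite -scalerBr rpredZ ?repr_pi. Qed.

Lemma quot_bracketE x y : quot_bracket (pi x) (pi y) = pi (bracket x y).
Proof.
apply/central_pi_eqP; rewrite (_ : _ - _ = 0) ?mem0v //; apply/eqP.
have /centreP zx := repr_pi x; have /centreP zy := repr_pi y.
have [zl _] := zx (repr (pi y)); have [_ zr] := zy x.
rewrite -[X in X == 0](subrKA (bracket x (repr (pi y)))) -linearB /= zr addr0.
by move: zl; rewrite -[bracket _ _]/(bracketr _ _) linearB /= => ->.
Qed.

Fact quot_scaleA a b (q : Q) : quot_scale a (quot_scale b q) = quot_scale (a * b) q.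
Proof. by have [x ->] := central_pi_surj q; rewrite !quot_scaleE scalerA. Qed.

Fact quot_scale1 : left_id 1 quot_scale.
Proof. by move=> q; have [x ->] := central_pi_surj q; rewrite quot_scaleE scale1r. Qed.

Fact quot_scaleDr : right_distributive quot_scale +%R.
Proof.
move=> a p q; have [x ->] := central_pi_surj p; have [y ->] := central_pi_surj q.
by rewrite -central_piD !quot_scaleE scalerDr central_piD.
Qed.

Fact quot_scaleDl (q : Q) : {morph quot_scale^~ q : a b / a + b}.
Proof.
move=> a b; have [x ->] := central_pi_surj q.
by rewrite !quot_scaleE scalerDl central_piD.
Qed.

HB.instance Definition _ := GRing.Zmodule_isLmodule.Build F Q
  quot_scaleA quot_scale1 quot_scaleDr quot_scaleDl.

Fact quot_bracket_bilinear : bilinear_for *:%R *:%R quot_bracket.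
Proof.
have piP a x y : a *: pi x + pi y = pi (a *: x + y).
  by rewrite central_piD; congr (_ + _); apply: quot_scaleE.
split=> r a p q; have [x ->] := central_pi_surj p;
  have [y ->] := central_pi_surj q; have [z ->] := central_pi_surj r.
- by rewrite piP !quot_bracketE bracketPl piP.
- by rewrite piP !quot_bracketE bracketPr piP.
Qed.

Fact quot_bracket_leibniz (p q r : Q) :
  quot_bracket p (quot_bracket q r)
  = quot_bracket (quot_bracket p q) r - quot_bracket (quot_bracket p r) q.
Proof.
have [x ->] := central_pi_surj p; have [y ->] := central_pi_surj q.
have [z ->] := central_pi_surj r.
by rewrite !quot_bracketE -central_piB bracket_leibniz.
Qed.

HB.instance Definition _ := Lmodule_isLeibniz.Build F Q
  quot_bracket_bilinear quot_bracket_leibniz.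

End CentralQuotient.

Section Statements.
Context {F : fieldType}.
Variable L : finLeibnizType F.

Definition extraspecial : Prop :=
  \dim (centre L) = 1%N /\ abelian_algebra (central_quotient L).

Definition upper_semimodular : Prop :=
  forall U : {vspace L}, is_subalgebra U -> upper_semimodular_in U.

(* The set J of the x with x^2 = 0; in general it is not a subspace. *)
Definition square_zero : {pred L} := [pred x | bracket x x == 0].

End Statements.

Arguments upper_semimodular {F} L.
Arguments extraspecial {F} L.
Arguments square_zero {F} L.
Arguments abelian_algebra {F} L.

(* Main.v *)
Require Import Defs.
From mathcomp Require Import all_boot all_order all_algebra.

(** In an extraspecial algebra every bracket is a multiple of one central
    vector, so the product is a bilinear form [x, y] = f(x, y) z whose two-sided
    radical is the centre Z = <z>.  A subspace is then a subalgebra as soon as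
    it contains Z, and a subalgebra not containing Z is totally isotropic for
    f, that is abelian ([subalgebraP]).  Intermediate subspaces of B containing
    Z, or of an abelian B, are therefore subalgebras, and this forces every
    maximal subalgebra of B to be a hyperplane of B ([maximal_codim1]).

    Upper semi-modularity thus asks only that U + B be a subalgebra whenever
    U :&: B is a hyperplane of B: it contains U as a hyperplane by the modular
    law for dimensions.  Suppose J is an abelian ideal.  If U or B contains Z,
    so does U + B; otherwise both are isotropic, so lie in J, and U + B, being
    contained in J, is abelian.

    Conversely let x and y be isotropic vectors with y not in <x>.  The line <x>
    meets <y> in 0, which is maximal in <y>, so <x> is maximal in <x, y>.  If
    [x, y] were nonzero, <x, y> would contain Z and the subalgebra <x> + Z
    would lie between <x> and <x, y>, hence be one of them; but [x, y] vanishes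
    both when Z lies in <x> and when y lies in <x> + Z.  Thus f vanishes on J,
    which makes J closed under sums; it is an ideal because it contains Z. *)

Import GRing.Theory.
Local Open Scope ring_scope.

Section Subalgebras.
Set Implicit Arguments.
Unset Strict Implicit.
Context {F : fieldType} {L : finLeibnizType F}.
Implicit Types (a : F) (x y z : L) (U V B M W : {vspace L}).

Lemma bracketDl x y z : bracket (x + y) z = bracket x z + bracket y z.
Proof. by rewrite -[LHS]/(bracketr z (x + y)) linearD. Qed.

Lemma bracketZl a x y : bracket (a *: x) y = a *: bracket x y.
Proof. by rewrite -[LHS]/(bracketr y (a *: x)) linearZ. Qed.

Lemma subalgebra_abelian U : is_abelian U -> is_subalgebra U.
Proof. by move=> aU x y Ux Uy; rewrite aU ?mem0v. Qed.

Lemma abelian_subv U V : (U <= V)%VS -> is_abelian V -> is_abelian U.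
Proof. by move=> /subvP sUV aV x y /sUV Vx /sUV Vy; apply: aV. Qed.

Lemma abelian_line x : bracket x x = 0 -> is_abelian <[x]>%VS.
Proof.
move=> xx _ _ /vlineP[a ->] /vlineP[b ->].
by rewrite bracketZl linearZ /= xx !scaler0.
Qed.

Lemma subalgebra_add_central U z : is_subalgebra U -> z \in centre L ->
  is_subalgebra (U + <[z]>)%VS.
Proof.
move=> aU /centreP cz _ _ /memv_addP[u Uu [_ /vlineP[c ->] ->]]
  /memv_addP[v Uv [_ /vlineP[d ->] ->]].
rewrite bracketDl bracketZl (cz _).1 scaler0 addr0 linearD linearZ /=.
by rewrite (cz u).2 scaler0 addr0 (subvP (addvSl _ _)) // aU.
Qed.

Lemma generated_subalgebra U B : is_subalgebra (U + B)%VS ->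
  generated U B = (U + B)%VS.
Proof.
move=> aUB; have [_ sU sB] := generatedP U B.
apply/eqP; rewrite eqEsubv subv_add sU sB !andbT.
by rewrite generated_min ?addvSl ?addvSr.
Qed.

Lemma codim1_maximal U V : is_subalgebra U -> (U <= V)%VS ->
  \dim V = (\dim U).+1 -> is_maximal_subalgebra U V.
Proof.
move=> aU sUV dV; split=> // [|W _ sUW sWV].
  by apply/eqP=> eUV; have := n_Sn (\dim U); rewrite -dV -eUV.
have [dWU|ltUW] := leqP (\dim W) (\dim U).
  by left; apply/esym/eqP; rewrite eqEdim sUW.
by right; apply/eqP; rewrite eqEdim sWV dV.
Qed.

Lemma capv_line0 U b : b \notin U -> (U :&: <[b]>)%VS = 0%VS.
Proof.
move=> nUb; apply/eqP; rewrite -subv0; apply/subvP=> v.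
rewrite memv_cap => /andP[Uv /vlineP[k vE]].
have [k0|nz_k] := eqVneq k 0; first by rewrite vE k0 scale0r mem0v.
by move: Uv; rewrite vE rpredZeq (negPf nz_k) (negPf nUb).
Qed.

Lemma dimv_add_line U b : b \notin U -> \dim (U + <[b]>) = (\dim U).+1.
Proof.
move=> nUb; rewrite dimv_disjoint_sum ?capv_line0 // dim_vline.
by rewrite (memPnC nUb) ?mem0v // addn1.
Qed.

(** If a vector b of B outside M can be adjoined to M without leaving the
    subalgebras, maximality leaves no room beyond the hyperplane M + <b>. *)
Lemma maximal_adjoin M B b : is_maximal_subalgebra M B ->
  b \in B -> b \notin M -> is_subalgebra (M + <[b]>)%VS ->
  \dim B = (\dim M).+1.
Proof.
move=> [_ sMB _ maxM] Bb nMb aMb.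
have sMbB : (M + <[b]> <= B)%VS by rewrite subv_add sMB -memvE.
have [eM|<-] := maxM _ aMb (addvSl _ _) sMbB; last exact: dimv_add_line.
by case/negP: nMb; rewrite -eM memvE addvSr.
Qed.

(** The line <x> is maximal in the subalgebra S generated by x and y, because 0
    is maximal in <y>.  Adjoining the central vector [x, y] to <x> gives a
    subalgebra W between <x> and S, so either [x, y] is a multiple of x, and x
    is central unless [x, y] = 0, or y is a combination of x and [x, y]; the
    product [x, y] vanishes in each case. *)
Lemma semimodular_isotropic_pair x y : upper_semimodular L ->
  bracket x x = 0 -> bracket y y = 0 -> bracket x y \in centre L ->
  bracket x y = 0.
Proof.
move=> usm xx yy Zxy.
have [/vlineP[k ->]|nxy] := boolP (y \in <[x]>%VS).
  by rewrite linearZ /= xx scaler0.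
have max0 : is_maximal_subalgebra (<[x]> :&: <[y]>)%VS <[y]>%VS.
  rewrite capv_line0 //; apply: codim1_maximal (sub0v _) _ => [u v|].
    rewrite !memv0 => /eqP-> _.
    by rewrite -[bracket 0 v]/(bracketr v 0) linear0.
  by rewrite dimv0 dim_vline (memPnC nxy) ?mem0v.
have ax := subalgebra_abelian (abelian_line xx).
have [_ _ _ maxx] :=
  usm _ ax _ (subalgebra_abelian (abelian_line yy)) max0.
set S := generated _ _ in maxx.
have [aS xS yS] : [/\ is_subalgebra S, (<[x]> <= S)%VS & (<[y]> <= S)%VS].
  exact: generatedP.
pose W := (<[x]> + <[bracket x y]>)%VS.
have aW : is_subalgebra W by exact: subalgebra_add_central.
have sWS : (W <= S)%VS.
  by rewrite subv_add xS -memvE; apply: aS; rewrite memvE.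
have [eW|eW] := maxx _ aW (addvSl _ _) sWS.
- have /vlineP[k xyE] : bracket x y \in <[x]>%VS by rewrite -eW memvE addvSr.
  move: Zxy; rewrite xyE rpredZeq => /orP[/eqP-> | /centreP/(_ y)[xy0 _]].
    by rewrite scale0r.
  by rewrite -xyE.
have : y \in W by rewrite eW memvE.
move=> /memv_addP[u /vlineP[a ->] [v /vlineP[b ->] ->]].
have /centreP cxy := Zxy.
by rewrite linearD !linearZ /= xx (cxy x).2 !scaler0 addr0.
Qed.

End Subalgebras.

Section Extraspecial.
Set Implicit Arguments.
Unset Strict Implicit.
Context {F : fieldType} {L : finLeibnizType F}.
Implicit Types (x y z : L) (U V B M W : {vspace L}).

Lemma bracket_centre : abelian_algebra (central_quotient L) ->
  forall x y, bracket x y \in centre L.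
Proof.
move=> abQ x y; have := abQ (central_pi x) (central_pi y).
rewrite [LHS]quot_bracketE -(subrr (central_pi 0)) -central_piB subrr.
by move=> /central_pi_eqP; rewrite subr0.
Qed.

Lemma subalgebra_centre U : extraspecial L -> (centre L <= U)%VS ->
  is_subalgebra U.
Proof. by move=> [_ /bracket_centre Zxy] /subvP ZU x y _ _; apply/ZU/Zxy. Qed.

(** Brackets of elements of U lie in the intersection of U with the line Z,
    which is Z or 0. *)
Lemma subalgebraP U : extraspecial L -> is_subalgebra U ->
  (centre L <= U)%VS \/ is_abelian U.
Proof.
move=> [dZ /bracket_centre Zxy] aU.
have [ZU|nZU] := boolP (centre L <= U)%VS; [by left | right=> x y Ux Uy].
apply: contraNeq nZU => nz_xy.
suff <- : <[bracket x y]>%VS = centre L by rewrite -memvE aU.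
by apply/eqP; rewrite eqEdim -memvE Zxy dZ dim_vline nz_xy.
Qed.

(** The adjoined vector is any element of B outside M when M contains Z or B
    is abelian, and has to be taken in Z otherwise. *)
Lemma maximal_codim1 M B : extraspecial L -> is_subalgebra B ->
  is_maximal_subalgebra M B -> \dim B = (\dim M).+1.
Proof.
move=> hL aB maxM; have [aM sMB neMB _] := maxM.
have /subvPn[b Bb nMb] : ~~ (B <= M)%VS.
  by apply: contraNN neMB => sBM; rewrite eqEsubv sMB.
have [ZM|/subvPn[z Zz nMz]] := boolP (centre L <= M)%VS.
  apply: maximal_adjoin maxM Bb nMb _.
  exact/(subalgebra_centre hL)/(subv_trans ZM)/addvSl.
have [ZB|abB] := subalgebraP hL aB.
  apply: maximal_adjoin maxM (subvP ZB _ Zz) nMz _.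
  exact: subalgebra_add_central.
apply: (maximal_adjoin maxM Bb nMb).
apply: subalgebra_abelian (abelian_subv _ abB).
by rewrite subv_add sMB -memvE.
Qed.

(** Outside the subspaces containing Z, the subalgebras are exactly the
    subspaces of J when J is an abelian subspace; sums of subspaces of J stay
    in J, and all other sums of subalgebras contain Z. *)
Lemma subalgebra_add U B : extraspecial L -> is_abelian_ideal (square_zero L) ->
  is_subalgebra U -> is_subalgebra B -> is_subalgebra (U + B)%VS.
Proof.
move=> hL [[[J0 Jlin] _] abJ] aU aB.
have JP V : is_abelian V -> {subset V <= square_zero L}.
  by move=> abV x Vx; rewrite inE abV.
have [ZU|/JP UJ] := subalgebraP hL aU.
  exact/(subalgebra_centre hL)/(subv_trans ZU)/addvSl.
have [ZB|/JP BJ] := subalgebraP hL aB.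
  exact/(subalgebra_centre hL)/(subv_trans ZB)/addvSr.
have UBJ : {subset (U + B)%VS <= square_zero L}.
  move=> _ /memv_addP[u /UJ Ju [b /BJ Jb ->]].
  by rewrite -[u]scale1r; apply: Jlin.
by apply: subalgebra_abelian => x y /UBJ Jx /UBJ Jy; apply: abJ.
Qed.

Lemma abelian_ideal_semimodular : extraspecial L ->
  is_abelian_ideal (square_zero L) -> upper_semimodular L.
Proof.
move=> hL hJ U aU B aB maxUB; have aUB := subalgebra_add hL hJ aU aB.
rewrite generated_subalgebra //; apply: codim1_maximal (addvSl _ _) _ => //.
apply/eqP; rewrite -(eqn_add2r (\dim (U :&: B))) dimv_sum_cap.
by rewrite (maximal_codim1 hL aB maxUB) addnS addSn.
Qed.

Lemma semimodular_abelian_ideal : abelian_algebra (central_quotient L) ->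
  upper_semimodular L -> is_abelian_ideal (square_zero L).
Proof.
move=> /bracket_centre Zxy usm.
have abJ : is_abelian (square_zero L).
  by move=> x y /eqP xx /eqP yy; apply: semimodular_isotropic_pair.
split=> //; split=> [|x _ y]; last first.
  by rewrite !inE; have /centreP/(_ (bracket x y))[-> _] := Zxy x y;
    have /centreP/(_ (bracket y x))[-> _] := Zxy y x; rewrite eqxx.
split=> [|a x y Jx Jy]; first by rewrite inE linear0.
rewrite inE bracketDl bracketZl !linearD /= !linearZ /=.
by rewrite !abJ // !scaler0 !addr0.
Qed.

End Extraspecial.

Theorem proposition4p7 (F : fieldType) (L : finLeibnizType F)
    (hL : extraspecial L) :
  upper_semimodular L <-> is_abelian_ideal (square_zero L).
Proof.
split; last exact: abelian_ideal_semimodular.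
by case: hL => _; apply: semimodular_abelian_ideal.
Qed.
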